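(* Let $(S_0,S_1,\dots)$ be a supermartingale relative to a nondecreasing sequence of $\sigma$-algebras $H_{\le0}\subseteq H_{\le1}\subseteq\cdots$, with $S_0\le0$ a.s. and differences $X_i:=S_i-S_{i-1}$. Let $d>0$ and $\sigma_i>0$ ($i=1,2,\dots$) be non-random constants such that $X_i\le d$ and $\operatorname{Var}(X_i\mid H_{\le i-1})\le\sigma_i^2$ a.s. for every $i$. Fix $n\ge1$, let $\sigma^2:=\frac1n(\sigma_1^2+\dots+\sigma_n^2)$ and $h:=d+\sigma^2/d$. Let $T_n:=Z_1+\dots+Z_n$, where $Z_1,\dots,Z_n$ are i.i.d. with $\mathbf{P}(Z_i=d)=\frac{\sigma^2}{d^2+\sigma^2}$ and $\mathbf{P}(Z_i=-\sigma^2/d)=\frac{d^2}{d^2+\sigma^2}$. Then $$\mathbf{P}(S_n\ge y)\le c_2\,\mathbf{P}^{\mathrm{Lin,LC}}\Big(T_n\ge y+\frac h2\Big)\quad\text{for all } y\in\mathbb{R},$$ where $c_2:=e^2/2$.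
   Context: $T_n$ takes values in the lattice $L_{n,d,h}:=\{nd+kh:k\in\mathbb{Z}\}$. The function $y\mapsto\mathbf{P}^{\mathrm{Lin}}(T_n\ge y)$ is the linear interpolation of the tail function $y\mapsto\mathbf{P}(T_n\ge y)$ over $L_{n,d,h}$: $\mathbf{P}^{\mathrm{Lin}}(T_n\ge y)=(1-\gamma)\mathbf{P}(T_n\ge nd+kh)+\gamma\mathbf{P}(T_n\ge nd+(k+1)h)$ whenever $\gamma:=(y-nd-kh)/h\in[0,1]$ for some $k\in\mathbb{Z}$. The function $y\mapsto\mathbf{P}^{\mathrm{Lin,LC}}(T_n\ge y)$ is the least log-concave majorant of $y\mapsto\mathbf{P}^{\mathrm{Lin}}(T_n\ge y)$ on $\mathbb{R}$, i.e. the pointwise smallest function $g:\mathbb{R}\to[0,\infty)$ with $\ln g$ concave (allowing the value $-\infty$) and $g\ge\mathbf{P}^{\mathrm{Lin}}(T_n\ge\cdot)$. *)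

(* Defs.v *)
From HB Require Import structures.
From mathcomp Require Import all_boot all_order all_algebra.
From mathcomp Require Import all_classical all_reals all_analysis measurable_realfun.
Set Implicit Arguments. Unset Strict Implicit. Unset Printing Implicit Defensive.
Import Order.TTheory GRing.Theory Num.Theory.
Local Open Scope classical_set_scope.
Local Open Scope ring_scope.

Section Defs.
Context {R : realType}.

Definition G_measurable {T} {dV} {V : measurableType dV}
  (G : set (set T)) (g : T -> V) : Prop :=
  forall B : set V, measurable B -> G (g @^-1` B).

Definition is_cond_exp {dT} {T : measurableType dT} (P : probability T R)
  (G : set (set T)) (X g : T -> R) : Prop :=
  [/\ G_measurable G g,
      P.-integrable setT (EFin \o g) &
      forall A, G A -> (\int[P]_(x in A) (g x)%:E = \int[P]_(x in A) (X x)%:E)%E].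

Definition is_cond_exp_nneg {dT} {T : measurableType dT} (P : probability T R)
  (G : set (set T)) (Y q : T -> \bar R) : Prop :=
  [/\ @G_measurable T _ (\bar R) G q,
      (forall x, (0 <= q x)%E) &
      forall A, G A -> (\int[P]_(x in A) q x = \int[P]_(x in A) Y x)%E].

Definition Zval (d s2 : R) (b : bool) : R := if b then d else - (s2 / d).
Definition Zprob (d s2 : R) (b : bool) : R :=
  if b then s2 / (d ^+ 2 + s2) else d ^+ 2 / (d ^+ 2 + s2).

(** P(T_n >= y), T_n = Z_1 + ... + Z_n with Z_i i.i.d., computed on the
    canonical product space {ffun 'I_n -> bool}. *)
Definition Ttail (n : nat) (d s2 : R) (y : R) : R :=
  \sum_(z : {ffun 'I_n -> bool} | y <= \sum_(i < n) Zval d s2 (z i))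
     \prod_(i < n) Zprob d s2 (z i).

Definition TtailLin (n : nat) (d s2 h : R) (y : R) : R :=
  let k : int := Num.floor ((y - n%:R * d) / h) in
  let gam := (y - n%:R * d - k%:~R * h) / h in
  (1 - gam) * Ttail n d s2 (n%:R * d + k%:~R * h)
  + gam * Ttail n d s2 (n%:R * d + (k + 1)%:~R * h).

Definition lnE (r : R) : \bar R := if r == 0 then -oo%E else (ln r)%:E.

Definition log_concave (g : R -> R) : Prop :=
  (forall x, 0 <= g x) /\
  forall x y t, 0 <= t <= 1 ->
    (t%:E * lnE (g x) + (1 - t)%R%:E * lnE (g y) <= lnE (g (t * x + (1 - t) * y)%R))%E.

(** Least log-concave majorant: pointwise infimum of all log-concave majorants
    (which is itself the smallest log-concave majorant). *)
Definition least_logconcave_majorant (f : R -> R) (y : R) : R :=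
  inf [set g y | g in [set g : R -> R | log_concave g /\ forall x, f x <= g x]].

Definition TtailLinLC (n : nat) (d s2 h : R) (y : R) : R :=
  least_logconcave_majorant (TtailLin n d s2 h) y.

End Defs.

(* Main.v *)
(* Write X = d - (d - X). If X <= d has conditional mean m <= 0 and variance at
   most v, then (X - r)_+ lies below the line e - k (d - X), e = (d - r)_+, for
   every slope k in [0, 1]; squaring, and choosing k = k0 d / (d - m) with k0
   optimal for m = 0, bounds E (S + X - t)_+^2 by its value for the centred
   two-point variable with variance v and values d, -v/d. Iterating bounds
   E (S_n - t)_+^2 by the moment of a sum of independent two-point variables, and
   moving two of their variances closer to each other, with fixed sum, increases
   that moment; so it is at most E (T_n - t)_+^2.
   If U is uniform on [-h/2, h/2] and independent of T_n, then
   E (T_n - t)_+^2 <= E (T_n + U - t)_+^2 by convexity, and T_n + U has the tail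
   x |-> P^Lin(T_n >= x + h/2). A log-concave majorant g of P^Lin lies below an
   exponential touching it at y + h/2, of rate l say. If l <= 0 then
   g(y + h/2) >= 1; otherwise E (T_n + U - t)_+^2 is at most
   2 l^-2 e^(l (y - t)) g(y + h/2), and t = y - 2/l in Markov's inequality
   P(S_n >= y) <= E (S_n - t)_+^2 / (y - t)^2 gives the factor e^2/2. *)
Require Import Defs.
From HB Require Import structures.
From mathcomp Require Import all_boot all_order all_algebra.
From mathcomp Require Import all_classical all_reals all_analysis measurable_realfun.
From mathcomp Require Import ring lra.
Import Order.TTheory GRing.Theory Num.Theory.
Import numFieldNormedType.Exports.
Local Open Scope classical_set_scope.
Local Open Scope ring_scope.

(** * Averaging the variances *)

Section averaging.
Context {R : realType}.
Implicit Types (c d u v t x : R) (V : R -> R).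

Definition sqpos x := (Num.max x 0) ^+ 2.

Lemma sqpos_ge0 x : 0 <= sqpos x.
Proof. exact: sqr_ge0. Qed.

Lemma sqpos_pos {x} : 0 <= x -> sqpos x = x ^+ 2.
Proof. by rewrite /sqpos => /max_idPl ->. Qed.

Lemma sqpos_neg {x} : x <= 0 -> sqpos x = 0.
Proof. by rewrite /sqpos => /max_idPr ->; rewrite expr0n. Qed.

Lemma sqpos_le x y : x <= y -> sqpos x <= sqpos y.
Proof.
move=> xy; apply: lerXn2r; last exact: le_max2.
all: by rewrite nnegrE le_max lexx orbT.
Qed.

Lemma invr_1Dratio d v : d != 0 ->
  (1 + v / d ^+ 2)^-1 = d ^+ 2 / (d ^+ 2 + v).
Proof.
by move=> dn0; rewrite (_ : 1 + _ = (d ^+ 2 + v) / d ^+ 2) ?invf_div//; field.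
Qed.

Lemma sqposZ d x : 0 <= d -> sqpos (d * x) = d ^+ 2 * sqpos x.
Proof. by move=> d0; rewrite /sqpos -exprMn maxr_pMr// mulr0. Qed.

(* With independent B_u, B_v, where B_u = u with probability 1/u and 0
   otherwise, this is E (c - B_u - B_v)_+^2. *)
Definition pair_moment c u v :=
  (1 - u^-1) * (1 - v^-1) * sqpos c + (1 - v^-1) * u^-1 * sqpos (c - u) +
  (1 - u^-1) * v^-1 * sqpos (c - v) + u^-1 * v^-1 * sqpos (c - (u + v)).

Lemma pair_moment_le0 c u v : 1 <= u -> 1 <= v -> c <= 0 ->
  pair_moment c u v = 0.
Proof.
move=> u1 v1 c0; rewrite /pair_moment.
have cu : c - u <= 0 by lra.
have cv : c - v <= 0 by lra.
have cuv : c - (u + v) <= 0 by lra.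
by rewrite !sqpos_neg// !mulr0 !addr0.
Qed.

(** Only the event where both variables are 0 contributes. The value is written through [u + v] and
    [u * v], so that at fixed sum it visibly grows with the product. *)
Lemma pair_moment_low c u v : 1 <= u -> 1 <= v -> 0 <= c -> c <= u -> c <= v ->
  pair_moment c u v = c ^+ 2 * (1 - (u + v - 1) / (u * v)).
Proof.
move=> u1 v1 c0 cu cv; rewrite /pair_moment (sqpos_pos c0).
have cu' : c - u <= 0 by lra.
have cv' : c - v <= 0 by lra.
have cuv : c - (u + v) <= 0 by lra.
rewrite !sqpos_neg//; field; apply/andP; split; lra.
Qed.

(** The variable of parameter [v] must be 0; the other factor is then the full second moment of
    [c - B_u], as [B_u] has mean 1 and second moment [u]. *)
Lemma pair_moment_mid c u v : 1 <= u -> 1 <= v -> u <= c -> c <= v ->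
  pair_moment c u v = (1 - v^-1) * (c ^+ 2 - c *+ 2 + u).
Proof.
move=> u1 v1 uc cv; rewrite /pair_moment.
have c0 : 0 <= c by lra.
have cu : 0 <= c - u by lra.
have cv' : c - v <= 0 by lra.
have cuv : c - (u + v) <= 0 by lra.
rewrite (sqpos_neg cv') (sqpos_neg cuv) (sqpos_pos c0) (sqpos_pos cu).
field; apply/andP; split; lra.
Qed.

(** The full second moment of [c - B_u - B_v], less the contribution of the event that both
    variables are nonzero, the only one where this difference is not positive. *)
Lemma pair_moment_high c u v : 1 <= u -> 1 <= v -> u <= c -> v <= c ->
  c <= u + v ->
  pair_moment c u v =
  c ^+ 2 - c *+ 4 + (u + v) + 2 - (u + v - c) ^+ 2 / (u * v).
Proof.
move=> u1 v1 uc vc cuv; rewrite /pair_moment.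
have c0 : 0 <= c by lra.
have cu : 0 <= c - u by lra.
have cv : 0 <= c - v by lra.
have cuv' : c - (u + v) <= 0 by lra.
rewrite (sqpos_neg cuv') (sqpos_pos c0) (sqpos_pos cu) (sqpos_pos cv).
field; apply/andP; split; lra.
Qed.

Lemma pair_moment_top c u v : 1 <= u -> 1 <= v -> u + v <= c ->
  pair_moment c u v = c ^+ 2 - c *+ 4 + (u + v) + 2.
Proof.
move=> u1 v1 uvc; rewrite /pair_moment.
have c0 : 0 <= c by lra.
have cu : 0 <= c - u by lra.
have cv : 0 <= c - v by lra.
have cuv' : 0 <= c - (u + v) by lra.
rewrite (sqpos_pos cuv') (sqpos_pos c0) (sqpos_pos cu) (sqpos_pos cv).
field; apply/andP; split; lra.
Qed.

Lemma mul_le_of_closer u v u' v' : u + v = u' + v' -> u <= u' -> u' <= v' ->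
  u * v <= u' * v'.
Proof.
move=> e uu' uv'; have -> : v = u' + v' - u by lra.
by rewrite -subr_ge0 (_ : _ - _ = (u' - u) * (v' - u)); [apply: mulr_ge0; lra|ring].
Qed.

Lemma pair_moment_low_le c u v u' v' : 1 <= u -> u <= u' -> u' <= v' ->
  u + v = u' + v' -> 0 <= c -> c <= u ->
  pair_moment c u v <= pair_moment c u' v'.
Proof.
move=> u1 uu' uv' e c0 cu; have vv' : v' <= v by lra.
rewrite !pair_moment_low//; try lra.
apply: ler_wpM2l; first exact: sqr_ge0.
rewrite lerD2l lerN2 e; apply: ler_wpM2l; first lra.
rewrite lef_pV2 ?posrE; [|apply: mulr_gt0; lra..].
exact: mul_le_of_closer.
Qed.

Lemma pair_moment_mid_le c u v u' v' : 1 <= u -> u <= u' -> u' <= v' ->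
  u + v = u' + v' -> u' <= c -> c <= v' ->
  pair_moment c u v <= pair_moment c u' v'.
Proof.
move=> u1 uu' uv' e u'c cv'; have vv' : v' <= v by lra.
rewrite !pair_moment_mid//; try lra.
have v0 : 0 < v by lra. have v'0 : 0 < v' by lra.
rewrite -subr_ge0.
have -> : (1 - v'^-1) * (c ^+ 2 - c *+ 2 + u') - (1 - v^-1) * (c ^+ 2 - c *+ 2 + u)
  = (u' - u) * (v * v' - (u' + v') - c ^+ 2 + c *+ 2) / (v * v').
  have -> : v = u' + v' - u by lra.
  by field; apply/andP; split; lra.
apply: divr_ge0; last by apply: mulr_ge0; lra.
apply: mulr_ge0; first lra.
(* The last factor of the numerator is the sum of these two products and of [c - u']. *)
have : 0 <= (v' - c) * (v - 1) by apply: mulr_ge0; lra.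
have : 0 <= c * (v - c) by apply: mulr_ge0; lra.
rewrite !expr2; nra.
Qed.

Lemma pair_moment_high_le c u v u' v' : 1 <= u -> u <= u' -> u' <= v' ->
  u + v = u' + v' -> v <= c -> c <= u + v ->
  pair_moment c u v <= pair_moment c u' v'.
Proof.
move=> u1 uu' uv' e vc cuv; have vv' : v' <= v by lra.
rewrite !pair_moment_high//; try lra.
rewrite e lerD2l lerN2; apply: ler_wpM2l; first exact: sqr_ge0.
rewrite lef_pV2 ?posrE; [|apply: mulr_gt0; lra..].
exact: mul_le_of_closer.
Qed.

(** On the way from [(u, v)] to [(u', v')] at fixed sum, [c] may change its position relative to the
    entries. The path is then cut at the pair that has [c] as an entry, where two formulas are valid
    at once, and each piece is covered by a single formula. *)
Lemma pair_moment_le c u v u' v' : 1 <= u -> u <= u' -> u' <= v' ->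
  u + v = u' + v' -> pair_moment c u v <= pair_moment c u' v'.
Proof.
move=> u1 uu' uv' e; have vv' : v' <= v by lra.
have [c0|c0] := leP c 0; first by rewrite !pair_moment_le0//; lra.
have [cu|cu] := leP c u; first by apply: pair_moment_low_le => //; lra.
have [cu'|cu'] := leP c u'.
  apply: (@le_trans _ _ (pair_moment c c (u + v - c))).
    by apply: pair_moment_mid_le => //; lra.
  by apply: pair_moment_low_le => //; lra.
have [cv'|cv'] := leP c v'; first by apply: pair_moment_mid_le => //; lra.
have [cv|cv] := leP c v.
  apply: (@le_trans _ _ (pair_moment c (u + v - c) c)).
    by apply: pair_moment_mid_le => //; lra.
  by apply: pair_moment_high_le => //; lra.
have [cuv|cuv] := leP c (u + v); first by apply: pair_moment_high_le => //; lra.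
by rewrite !pair_moment_top//; lra.
Qed.

(* [two_point d u] averages over the centred two-point law on
   {d, -(u - 1) d}, whose variance is (u - 1) d^2. *)
Definition two_point d u V t := (1 - u^-1) * V (t - d) + u^-1 * V (t - d + u * d).

Lemma two_point_le d u V V' t : 1 <= u -> (forall t, V t <= V' t) ->
  two_point d u V t <= two_point d u V' t.
Proof.
move=> u1 VV'; have u0 : 0 < u by lra.
apply: lerD; apply: ler_wpM2l => //; last by rewrite invr_ge0 ltW.
by rewrite subr_ge0 invf_le1.
Qed.

Lemma two_point_ge0 d u V t : 1 <= u -> (forall t, 0 <= V t) ->
  0 <= two_point d u V t.
Proof.
move=> u1 V0; have u0 : 0 < u by lra.
apply: addr_ge0; apply: mulr_ge0 => //; last by rewrite invr_ge0 ltW.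
by rewrite subr_ge0 invf_le1.
Qed.

Lemma two_pointC d u v V t :
  two_point d u (two_point d v V) t = two_point d v (two_point d u V) t.
Proof.
rewrite /two_point.
have -> : t - d + u * d - d + v * d = t - d + v * d - d + u * d by ring.
have -> : t - d - d + v * d = t - d + v * d - d by ring.
have -> : t - d - d + u * d = t - d + u * d - d by ring.
ring.
Qed.

Definition two_points d (us : seq R) V := foldr (two_point d) V us.

Lemma two_points_le d us V V' t : all (fun u => 1 <= u) us ->
  (forall t, V t <= V' t) -> two_points d us V t <= two_points d us V' t.
Proof.
elim: us t => [|u us IH] t /=; first by move=> _; exact.
by move=> /andP[u1 us1] VV'; apply: two_point_le => // t'; exact: IH.
Qed.

Lemma two_points_rcons d us u V :
  two_points d (rcons us u) V = two_points d us (two_point d u V).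
Proof. by rewrite /two_points foldr_rcons. Qed.

Lemma eq_two_point d u V V' : V =1 V' -> two_point d u V =1 two_point d u V'.
Proof. by move=> /funext ->. Qed.

Lemma two_points_rot d us u V :
  two_points d (u :: us) V =1 two_points d us (two_point d u V).
Proof.
elim: us => //= v us IH t.
rewrite two_pointC; apply: eq_two_point; exact: IH.
Qed.

(** The averaging operators commute, so any two entries can be made the innermost ones. *)
Lemma perm_two_points d us vs V : perm_eq us vs ->
  two_points d us V =1 two_points d vs V.
Proof.
elim: us vs => [|u us IH] vs; first by rewrite perm_sym => /perm_nilP ->.
move=> uvs; have uin : u \in vs by rewrite -(perm_mem uvs) mem_head.
move: uvs; case/splitPr: uin => v1 v2.
rewrite perm_sym perm_catC /= perm_cons perm_catC perm_sym => /IH e t.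
rewrite /= (eq_two_point _ _ _ _ e) {IH e}.
rewrite /two_points !foldr_cat /= -/(two_points d v1).
exact: two_points_rot.
Qed.

(** The centred two-point variable is [d * (1 - B_u)], so the sum of two of them minus [t] is
    [d * (c - B_u - B_v)] with [c = (2 * d - t) / d]. *)
Lemma two_point_pair d u v t : 0 < d -> 
  two_point d u (two_point d v (fun t => sqpos (- t))) t =
  d ^+ 2 * pair_moment ((2 * d - t) / d) u v.
Proof.
move=> d0; rewrite /two_point /pair_moment.
have h x y : y = d * x -> sqpos y = d ^+ 2 * sqpos x.
  by move=> ->; rewrite sqposZ// ltW.
rewrite (h ((2 * d - t) / d)); last by field; lra.
rewrite (h ((2 * d - t) / d - v) (- (t - d - d + v * d))); last by field; lra.
rewrite (h ((2 * d - t) / d - u) (- (t - d + u * d - d))); last by field; lra.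
rewrite (h ((2 * d - t) / d - (u + v)) (- (t - d + u * d - d + v * d))); last by field; lra.
ring.
Qed.

Lemma two_point_pair_le d u v u' v' t : 0 < d -> 1 <= u ->
  u <= u' <= v -> u <= v' <= v -> u + v = u' + v' ->
  two_point d u (two_point d v (fun t => sqpos (- t))) t <=
  two_point d u' (two_point d v' (fun t => sqpos (- t))) t.
Proof.
move=> d0 u1 /andP[uu' u'v] /andP[uv' v'v] e.
wlog uv : u' v' uu' u'v uv' v'v e / u' <= v'.
  move=> W; have [|vu] := leP u' v'; first exact: W.
  by rewrite (two_pointC _ u'); apply: W => //; [lra|exact: ltW].
rewrite !two_point_pair//; apply: ler_wpM2l; first exact: sqr_ge0.
exact: pair_moment_le.
Qed.

Lemma exists_le_mean (us : seq R) w : us != [::] ->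
  \sum_(u <- us) u <= (size us)%:R * w -> exists2 a, a \in us & a <= w.
Proof.
elim: us => // u us IH _; rewrite big_cons /= -natr1 mulrDl mul1r => H.
have [uw|wu] := leP u w; first by exists u => //; rewrite mem_head.
case: us IH H => [|v us] IH H.
  by rewrite big_nil mul0r in H; exfalso; lra.
have [//||a ain aw] := IH; first by lra.
by exists a => //; rewrite inE ain orbT.
Qed.

Lemma exists_ge_mean (us : seq R) w : us != [::] ->
  (size us)%:R * w <= \sum_(u <- us) u -> exists2 a, a \in us & w <= a.
Proof.
elim: us => // u us IH _; rewrite big_cons /= -natr1 mulrDl mul1r => H.
have [uw|wu] := leP w u; first by exists u => //; rewrite mem_head.
case: us IH H => [|v us] IH H.
  by rewrite big_nil mul0r in H; exfalso; lra.
have [//||a ain aw] := IH; first by lra.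
by exists a => //; rewrite inE ain orbT.
Qed.

(* Replacing a <= w <= b by w and a + b - w keeps the sum and makes one more
   entry equal to the mean. *)
Lemma two_points_mean d us w t : 0 < d -> all (fun u => 1 <= u) us ->
  \sum_(u <- us) u = (size us)%:R * w ->
  two_points d us (fun t => sqpos (- t)) t <=
  two_points d (nseq (size us) w) (fun t => sqpos (- t)) t.
Proof.
move=> d0; move en : (size us) => n; elim: n us en t => [|n IH] us en t us1 sumE.
  by move/size0nil: en => ->.
have us0 : us != [::] by rewrite -size_eq0 en.
have [a ain aw] : exists2 a, a \in us & a <= w.
  by apply: exists_le_mean => //; rewrite sumE en.
have pa := perm_to_rem ain.
have sz : size (rem a us) = n by rewrite size_rem// en.
have sum_rem : \sum_(u <- us) u = a + \sum_(u <- rem a us) u.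
  by rewrite (perm_big _ pa) big_cons.
rewrite (perm_two_points _ _ _ _ pa).
have /andP[a1 rem1] : (1 <= a) && all (fun u => 1 <= u) (rem a us).
  by rewrite -[_ && _]/(all _ (_ :: _)) -(perm_all _ pa).
case: n => [|n] in IH en sz sumE *.
  move: sumE; rewrite sum_rem (size0nil sz) big_nil mul1r addr0 => ->.
  by [].
have rem0 : rem a us != [::] by rewrite -size_eq0 sz.
have [b bin wb] : exists2 b, b \in rem a us & w <= b.
  apply: exists_ge_mean => //; rewrite sz.
  by move: sumE; rewrite sum_rem -natr1 mulrDl mul1r; lra.
have pb := perm_to_rem bin.
move: (rem b (rem a us)) pb => vs pb.
have szv : size vs = n.
  by have := perm_size pb; rewrite sz /= => -[].
have sumv : \sum_(u <- rem a us) u = b + \sum_(u <- vs) u.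
  by rewrite (perm_big _ pb) big_cons.
have /andP[b1 vs1] : (1 <= b) && all (fun u => 1 <= u) vs.
  by rewrite -[_ && _]/(all _ (_ :: _)) -(perm_all _ pb).
apply: (@le_trans _ _ (two_points d (w :: (a + b - w) :: vs) (fun t => sqpos (- t)) t)).
  (* The pair inequality is about [sqpos] itself, so the two changed entries go to the inside; the
     outer operators are monotone. *)
  have rot2 x y : two_points d (x :: y :: vs) (fun t => sqpos (- t)) =1
      two_points d vs (two_point d x (two_point d y (fun t => sqpos (- t)))).
    move=> t'; rewrite (perm_two_points _ _ (rcons (rcons vs x) y)); last first.
      by rewrite -!cats1 -catA /= perm_sym perm_catC.
    by rewrite !two_points_rcons.
  have -> : two_points d (a :: rem a us) (fun t => sqpos (- t)) t
      = two_points d (a :: b :: vs) (fun t => sqpos (- t)) t.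
    by apply: perm_two_points; rewrite perm_cons.
  rewrite !rot2; apply: two_points_le => // t'.
  by apply: two_point_pair_le => //; lra.
have w1 : 1 <= w by lra.
rewrite /=; apply: two_point_le; first lra.
move=> t'; apply: (IH (a + b - w :: vs)) => /=.
- by rewrite szv.
- by rewrite vs1 andbT; lra.
- rewrite big_cons; move: sumE; rewrite sum_rem sumv -(natr1 n.+1) mulrDl mul1r; lra.
Qed.

End averaging.

(** * One step of the supermartingale *)

Section conditioning.
Context {R : realType} {dT : measure_display} {T : measurableType dT}.
Variable P : probability T R.
Implicit Types (G : set (set T)) (Y w m : T -> R).

(** The sum is the integer part of [x]. It serves to replace a bounded weight by a combination of
    indicators of its superlevel sets. *)
Lemma layer_sum_approx (x : R) (K : nat) : 0 <= x <= K%:R ->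
  `|x - \sum_(j < K) (j.+1%:R <= x)%R%:R| <= 1.
Proof.
elim: K x => [|K IH] x /andP[x0 xK]; first by rewrite big_ord0 ger0_norm; lra.
have [x1|x1] := leP 1 x.
  rewrite big_ord_recl x1 opprD addrA.
  have := IH (x - 1); rewrite -natr1 in xK.
  have -> : \sum_(j < K) (j.+1%:R <= x - 1)%R%:R =
      \sum_(i < K) ((bump 0 i).+1%:R <= x)%R%:R :> R.
    by apply: eq_bigr => i _; rewrite /bump /= add1n -(natr1 i.+1) lerBrDr.
  by apply; lra.
rewrite big1 ?subr0 ?ger0_norm//; first lra.
move=> j _; rewrite leNgt (lt_le_trans x1)//.
by rewrite -[1]/(1%:R) ler_nat.
Qed.

Lemma lee0_of_harmonic (x : \bar R) (c : R) : 
  (forall N : nat, (x <= (N.+1%:R^-1 * c)%:E)%E) -> (x <= 0)%E.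
Proof.
case: x => [r| |//] H; last by have := H 0%N.
rewrite lee_fin leNgt; apply/negP => r0.
have [c0|c0] := leP c 0.
  have := H 0%N; rewrite lee_fin invr1 mul1r => rc; lra.
have := H (Num.truncn (c / r)); rewrite lee_fin mulrC ler_pdivlMr//.
have := truncnS_gt (c / r); rewrite ltr_pdivrMr// => h1 h2.
by rewrite mulrC in h2; lra.
Qed.

(** Up to an error [1 / (N + 1)], the weight is a nonnegative combination of indicators of sets of
    [G], over each of which [Y] has a nonpositive integral; the error costs at most
    [E |Y| / (N + 1)]. *)
Lemma integral_weight_le0 G Y w (M : R) :
  (forall a, G [set x | a <= w x]) -> G `<=` measurable ->
  (forall x, 0 <= w x <= M) -> P.-integrable setT (EFin \o Y) ->
  P.-integrable setT (EFin \o (fun x => w x * Y x)) ->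
  (forall A, G A -> (\int[P]_(x in A) (Y x)%:E <= 0)%E) ->
  (\int[P]_x (w x * Y x)%:E <= 0)%E.
Proof.
move=> Gw Gm w0 iY iwY YG.
have iaY : P.-integrable setT (EFin \o (fun x => `|Y x|)) by exact: integrable_norm.
apply: (@lee0_of_harmonic _ (fine (\int[P]_x `|Y x|%:E))) => N.
pose K := (Num.truncn (N.+1%:R * M)).+1.
pose A (j : 'I_K) := [set x | j.+1%:R / N.+1%:R <= w x].
have GA j : G (A j) by exact: Gw.
have mA j : measurable (A j) by exact: Gm.
pose Yj (j : 'I_K) := (EFin \o Y) \_ (A j).
have iYj j : P.-integrable setT (Yj j).
  have [+ _] := @integrable_mkcond _ T R P (A j) (EFin \o Y) (mA j); apply.
  exact: (integrableS _ _ _ iY).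
have isum : P.-integrable setT (fun x => \sum_(j < K) Yj j x)%E.
  by apply: integrable_sum.
(* [F] replaces [N.+1%:R * w x] by its integer part and pays [|Y x|] for the rounding. *)
pose F := fun x => (N.+1%:R^-1%:E * ((\sum_(j < K) Yj j x) + `|Y x|%:E))%E.
have iF : P.-integrable setT F.
  by apply: integrableZl => //; apply: integrableD.
have le_F : (\int[P]_x (w x * Y x)%:E <= \int[P]_x F x)%E.
  apply: le_integral => // x _; rewrite /F.
  have -> : (\sum_(j < K) Yj j x)%E =
      ((\sum_(j < K) (j.+1%:R <= N.+1%:R * w x)%R%:R) * Y x)%:E.
    rewrite big_distrl /= -sumEFin; apply: eq_bigr => j _.
    rewrite /Yj patchE (_ : (x \in A j) = (j.+1%:R <= N.+1%:R * w x)).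
      by case: ifP; rewrite ?mul1r ?mul0r.
    rewrite mulrC -[RHS](ler_pdivrMr _ _ (ltr0Sn _ N)).
    by apply/idP/idP => [/set_mem//|?]; exact/mem_set.
  rewrite -EFinD -EFinM lee_fin [leRHS]mulrC ler_pdivlMr//.
  set s := \sum_(j < K) _.
  have : `|N.+1%:R * w x - s| <= 1.
    apply: layer_sum_approx; case/andP: (w0 x) => wx0 wxM.
    rewrite mulr_ge0//=; apply/ltW/(le_lt_trans _ (truncnS_gt _)).
    by rewrite ler_wpM2l.
  move=> sN; have : (N.+1%:R * w x - s) * Y x <= `|Y x|.
    apply: (le_trans (ler_norm _)); rewrite normrM.
    by rewrite -[leRHS]mul1r ler_wpM2r.
  by rewrite mulrBl; lra.
apply: (le_trans le_F); rewrite /F integralZl//; last exact: integrableD.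
rewrite EFinM lee_pmul2l//.
rewrite integralD// fineK; last by apply: integrable_fin_num.
rewrite integral_sum//; apply: geeDr.
apply: sume_le0 => j _; rewrite /Yj -integral_mkcond; exact: YG.
Qed.

(** Testing on the set [0 < m], which belongs to [G], shows that [|m|] has integral 0 there. *)
Lemma ae_le0_of_integral G m : G `<=` measurable -> G_measurable G m ->
  P.-integrable setT (EFin \o m) ->
  (forall A, G A -> (\int[P]_(x in A) (m x)%:E <= 0)%E) ->
  {ae P, forall x, m x <= 0}.
Proof.
move=> Gm mG im H.
pose A := [set x | 0 < m x].
have GA : G A.
  have -> : A = m @^-1` `]0, +oo[.
    by apply/seteqP; split=> x /=; rewrite in_itv/= andbT.
  by apply: mG; exact: measurable_itv.
have mA : measurable A by exact: Gm.
have imA : P.-integrable A (EFin \o m) by exact: (integrableS _ _ _ im).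
have : (\int[P]_(x in A) `|(EFin \o m) x| = 0)%E.
  apply/eqP; rewrite eq_le; apply/andP; split; last first.
    by apply: integral_ge0 => x _; exact: abse_ge0.
  rewrite (eq_integral (fun x => (m x)%:E)); first exact: H.
  by move=> x /set_mem; rewrite /A /= => mx; rewrite ger0_norm// ltW.
move=> /(ae_eq_integral_abs _ mA (measurable_int _ imA)); apply: filterS => x /= mx.
rewrite leNgt; apply/negP => m0.
by have := mx m0 => -[] e; rewrite e ltxx in m0.
Qed.

(* The k in [0, 1] that minimises E (e - k (d - X))^2 for X centred with
   variance v. *)
Definition slope (d v e : R) := Num.min 1 (e * d / (d ^+ 2 + v)).

Lemma slope_itv (d v e : R) : 0 < d -> 0 < v -> 0 <= e -> 0 <= slope d v e <= 1.
Proof.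
move=> d0 v0 e0; rewrite /slope ge_min lexx /= le_min ler01 /=.
by rewrite divr_ge0// ?mulr_ge0// ?addr_ge0 ?sqr_ge0// ltW.
Qed.

(** Keeps the intercept [e - k * d] nonnegative, hence also the weight that multiplies the centred
    increment in [sqpos_step]. *)
Lemma slope_le (d v e : R) : 0 < d -> 0 < v -> 0 <= e -> slope d v e * d <= e.
Proof.
move=> d0 v0 e0; have D0 : 0 < d ^+ 2 + v by rewrite ltr_wpDl ?sqr_ge0.
apply: (@le_trans _ _ (e * d / (d ^+ 2 + v) * d)).
  by rewrite ler_wpM2r ?(ltW d0)// /slope ge_min lexx orbT.
rewrite mulrAC ler_pdivrMr// -mulrA; apply: ler_wpM2l => //.
by rewrite -expr2 lerDl ltW.
Qed.

(** The line bound is exact for the two-point law on [d] and [- v / d]: with the interior slope the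
    line vanishes at [- v / d], and with slope 1 it is the identity up to a shift and is nonnegative
    at both atoms. *)
Lemma slope_value (d v e : R) : 0 < d -> 0 < v -> 0 <= e ->
  (e - slope d v e * d) ^+ 2 + slope d v e ^+ 2 * v =
  (1 - (1 + v / d ^+ 2)^-1) * sqpos e +
  (1 + v / d ^+ 2)^-1 * sqpos (e - (1 + v / d ^+ 2) * d).
Proof.
move=> d0 v0 e0; have D0 : 0 < d ^+ 2 + v by rewrite ltr_wpDl ?sqr_ge0.
have dn0 : d != 0 by rewrite gt_eqF.
have ne : (d ^+ 2 + v != 0) by rewrite gt_eqF.
have E : (1 + v / d ^+ 2) * d = (d ^+ 2 + v) / d by field.
have Einv := invr_1Dratio d v dn0.
rewrite E Einv /slope (sqpos_pos e0).
have [h|h] := leP (e * d / (d ^+ 2 + v)) 1.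
  rewrite sqpos_neg; first by field; exact: ne.
  by rewrite subr_le0 ler_pdivlMr//; rewrite ler_pdivrMr// mul1r in h.
rewrite sqpos_pos; first by field; rewrite dn0 ne.
by rewrite subr_ge0 ler_pdivrMr//; rewrite ltr_pdivlMr// mul1r in h; exact: ltW.
Qed.

(** Where [X > r], the line dominates because [k * (d - X) <= d - X]; elsewhere the left side is 0
    and any square will do. *)
Lemma sqpos_le_line (d k e X : R) : 0 <= k <= 1 -> 0 <= e -> X <= d ->
  forall r, d - r <= e -> sqpos (X - r) <= (e - k * (d - X)) ^+ 2.
Proof.
move=> /andP[k0 k1] e0 Xd r dre.
have [Xr|Xr] := leP (X - r) 0; first by rewrite sqpos_neg// sqr_ge0.
rewrite (sqpos_pos (ltW Xr)) ler_sqr ?nnegrE; [|exact: ltW|];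
  have : k * (d - X) <= 1 * (d - X) by apply: ler_wpM2r; lra.
- by lra.
- by lra.
Qed.


Lemma G_measurable_fun {G dV} {V : measurableType dV} {g : T -> V} :
  G `<=` measurable -> G_measurable G g -> measurable_fun setT g.
Proof. by move=> Gm gG _ B mB; rewrite setTI; apply: Gm; exact: gG. Qed.

Lemma G_measurable_sigma {G dV} {V : measurableType dV} {g : T -> V} :
  G_measurable G g -> measurable_fun (setT : set (g_sigma_algebraType G)) g.
Proof. by move=> gG _ B mB; rewrite setTI; apply: sub_sigma_algebra; exact: gG. Qed.

Lemma G_measurable_of_sigma {G dV} {V : measurableType dV} {g : T -> V} :
  sigma_algebra setT G ->
  measurable_fun (setT : set (g_sigma_algebraType G)) g -> G_measurable G g.
Proof.
move=> sG mg B mB; have := mg measurableT B mB.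
by rewrite setTI /measurable /= sigma_algebra_id.
Qed.

Lemma G_measurable_ge G w (a : R) : G_measurable G w -> G [set x | a <= w x].
Proof.
move=> Gw; have -> : [set x | a <= w x] = w @^-1` `[a, +oo[.
  by apply/seteqP; split=> x /=; rewrite in_itv/= andbT.
by apply: Gw; exact: measurable_itv.
Qed.

Lemma bounded_itv {w} {M : R} : (forall x, 0 <= w x <= M) ->
  [bounded w x | x in setT].
Proof.
move=> wM; exists M; split; first exact: num_real.
move=> y My x _; case/andP: (wM x) => w0 wx.
by rewrite /= ger0_norm// (le_trans wx)// ltW.
Qed.

Lemma measurable_slope {d'} {U : measurableType d'} (d v : R) (e : U -> R) :
  measurable_fun setT e -> measurable_fun setT (fun x => slope d v (e x)).
Proof.
move=> me; apply: measurable_minr => //.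
by apply: measurable_funM => //; apply: measurable_funM.
Qed.

(** Gives the measurability of the factor [z] of [sqpos_step]. The truncation at 0 keeps the
    denominator at least [d]. *)
Lemma nondecreasing_ratio (d : R) : 0 < d ->
  {homo (fun s : R => d / (d - Num.min s 0)) : x y / x <= y}.
Proof.
move=> d0 x y xy; have my (s : R) : Num.min s 0 <= 0 by rewrite ge_min lexx orbT.
have := my x; have := my y => h1 h2.
apply: ler_wpM2l; first exact: ltW.
rewrite lef_pV2 ?posrE; [|lra|lra].
by rewrite lerD2l lerN2; apply: le_min2.
Qed.

Lemma measurable_sqpos (f : T -> R) (t : R) : measurable_fun setT f ->
  measurable_fun setT (fun x => (sqpos (f x - t))%:E).
Proof.
move=> mf; apply/measurable_EFinP/measurable_funX; apply: measurable_maxr => //.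
exact: measurable_funB.
Qed.

(** The squared line is bounded by a [G]-measurable [g0] plus [w1 * Y + w2 * Z], where the weights
    are bounded, nonnegative and [G]-measurable, and where [Y], the centred increment, and
    [Z = Y ^+ 2 - v] have nonpositive integrals over all sets of [G]. *)
Lemma sqpos_step G (S S' m : T -> R) (q : T -> \bar R) (d v B t : R) :
  sigma_algebra setT G -> G `<=` measurable -> G_measurable G S ->
  P.-integrable setT (EFin \o S) -> P.-integrable setT (EFin \o S') ->
  {ae P, forall x, S x <= B} -> {ae P, forall x, S' x - S x <= d} ->
  is_cond_exp P G (fun x => S' x - S x) m -> {ae P, forall x, m x <= 0} ->
  is_cond_exp_nneg P G (fun x => ((S' x - S x - m x) ^+ 2)%:E) q ->
  {ae P, forall x, (q x <= v%:E)%E} -> 0 < d -> 0 < v ->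
  (\int[P]_x (sqpos (S' x - t))%:E <=
   \int[P]_x (two_point d (1 + v / d ^+ 2) (fun t => sqpos (S x - t)) t)%:E)%E.
Proof.
move=> sG Gm GS iS iS' SB Xd [Gmm im condm] m0 [Gq q0 condq] qv d0 v0.
(* Since [S <= B] almost surely, cutting at [C] changes [e] only on a null set, and it makes [e]
   bounded everywhere. *)
pose C := B + d - t.
pose e x : R := Num.max 0 (Num.min (S x + d - t) C).
pose k0 x : R := slope d v (e x).
pose b x : R := e x - k0 x * d.
(* Almost surely [z * (d - m) = d], which turns [e - k * (d - X)] into [b + k * (X - m)] with the
   intercept [b] of the centred case. Also [z <= 1], so [k <= k0]. *)
pose z x : R := d / (d - Num.min (m x) 0).
pose k x : R := k0 x * z x.
pose Y x : R := S' x - S x - m x.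
have e0 x : 0 <= e x by rewrite /e le_max lexx.
have eC x : e x <= `|C|.
  by rewrite /e ge_max normr_ge0 /= ge_min ler_norm orbT.
have k01 x : 0 <= k0 x <= 1 by exact: slope_itv.
have b0 x : 0 <= b x by rewrite subr_ge0 slope_le.
have be x : b x <= e x by rewrite gerBl mulr_ge0//; [case/andP: (k01 x)|exact: ltW].
have z01 x : 0 <= z x <= 1.
  have : Num.min (m x) 0 <= 0 by rewrite ge_min lexx orbT.
  rewrite /z => mx; rewrite divr_ge0 ?(ltW d0)//=; last lra.
  by rewrite ler_pdivrMr; lra.
have kk0 x : 0 <= k x <= k0 x.
  case/andP: (k01 x) => h0 h1; case/andP: (z01 x) => z0 z1.
  by rewrite /k mulr_ge0//= ler_piMr.
(* Measurability with respect to [G] is derived on this type and carried back, [G] being a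
   sigma-algebra. *)
pose TG := g_sigma_algebraType G.
have mS : measurable_fun (setT : set TG) S by exact: G_measurable_sigma.
have mm : measurable_fun (setT : set TG) m by exact: G_measurable_sigma.
have me : measurable_fun (setT : set TG) e.
  apply: measurable_maxr => //; apply: measurable_minr => //.
  by apply: measurable_funB => //; apply: measurable_funD.
have mk0 : measurable_fun (setT : set TG) k0 by exact: measurable_slope.
have mb : measurable_fun (setT : set TG) b.
  by apply: measurable_funB => //; apply: measurable_funM.
have mz : measurable_fun (setT : set TG) z.
  have mr : measurable_fun setT (fun s : R => d / (d - Num.min s 0)).
    by apply: nondecreasing_measurable => //; exact: nondecreasing_ratio.
  exact: (measurableT_comp mr mm).
have mk : measurable_fun (setT : set TG) k by exact: measurable_funM.
pose w1 x : R := 2 * b x * k x.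
pose w2 x : R := k x ^+ 2.
have Gw1 : G_measurable G w1.
  apply: G_measurable_of_sigma => //; apply: measurable_funM => //.
  exact: measurable_funM.
have Gw2 : G_measurable G w2.
  by apply: G_measurable_of_sigma => //; exact: measurable_funX.
pose g0 x : R := b x ^+ 2 + k0 x ^+ 2 * v.
have Gg0 : G_measurable G g0.
  apply: G_measurable_of_sigma => //; apply: measurable_funD.
    exact: measurable_funX.
  by apply: measurable_funM => //; exact: measurable_funX.
have w1b x : 0 <= w1 x <= 2 * `|C|.
  case/andP: (kk0 x) => h0 h1; case/andP: (k01 x) => h2 h3.
  rewrite /w1; apply/andP; split; first by apply: mulr_ge0 => //; apply: mulr_ge0.
  rewrite -[leRHS]mulr1; apply: ler_pM => //.
  - by rewrite mulr_ge0.
  - by rewrite ler_wpM2l// (le_trans (be x)).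
  - exact: le_trans h3.
have w2b x : 0 <= w2 x <= 1.
  case/andP: (kk0 x) => h0 h1; case/andP: (k01 x) => h2 h3.
  by rewrite /w2 sqr_ge0 expr_le1//; exact: le_trans h3.
have g0b x : 0 <= g0 x <= `|C| ^+ 2 + v.
  case/andP: (k01 x) => h2 h3.
  rewrite /g0 addr_ge0 ?sqr_ge0 ?mulr_ge0 ?sqr_ge0 ?(ltW v0)//=.
  apply: lerD; first by rewrite ler_sqr ?nnegrE// (le_trans (be x)).
  by rewrite ler_piMl ?(ltW v0)// expr_le1.
have iY : P.-integrable setT (EFin \o Y).
  have -> : EFin \o Y = (((EFin \o S') \- (EFin \o S)) \- (EFin \o m))%E.
    by apply/funext => x.
  by apply: integrableB => //; apply: integrableB.
have mY : measurable_fun setT Y by apply/measurable_EFinP; exact: measurable_int iY.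
have mY2 : measurable_fun setT (fun x => Y x ^+ 2) by exact: measurable_funX.
have mq : measurable_fun setT q by exact: G_measurable_fun Gq.
have q_le A : measurable A -> (\int[P]_(x in A) q x <= \int[P]_(x in A) cst v%:E x)%E.
  move=> mA; apply: ae_ge0_le_integral => //.
  - exact: measurable_funS mq.
  - by move=> x _ /=; rewrite lee_fin ltW.
  - by apply: filterS qv => x ? _.
have GT : G setT by case: sG => G0 GC _; rewrite -(setD0 setT); exact: GC.
(* Square integrability is a consequence of the variance bound: the integral of [Y ^+ 2] is that of
   [q], at most [v]. *)
have iY2 : P.-integrable setT (EFin \o (fun x => Y x ^+ 2)).
  apply/integrableP; split; first exact/measurable_EFinP.
  rewrite (eq_integral (fun x => (Y x ^+ 2)%:E)); last first.
    by move=> x _ /=; rewrite ger0_norm ?sqr_ge0.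
  rewrite -(condq _ GT); apply: (le_lt_trans (q_le _ measurableT)).
  rewrite integral_cst//; apply: lte_mul_pinfty => //.
    by rewrite lee_fin ltW.
  exact: (le_lt_trans (probability_le1 P measurableT) (ltry _)).
pose Z x : R := Y x ^+ 2 - v.
have icst : P.-integrable setT (EFin \o cst v).
  by apply: finite_measure_integrable_cst.
have iZ : P.-integrable setT (EFin \o Z).
  have -> : EFin \o Z = ((EFin \o (fun x => Y x ^+ 2)%R) \- (EFin \o cst v))%E.
    by apply/funext => x.
  exact: integrableB.
have Z_le0 A : G A -> (\int[P]_(x in A) (Z x)%:E <= 0)%E.
  move=> GA; have mA := Gm _ GA.
  rewrite (eq_integral ((EFin \o (fun x => Y x ^+ 2)%R) \- (EFin \o cst v))%E)//.
  rewrite integralB//; [|exact: (integrableS _ _ _ iY2)|exact: (integrableS _ _ _ icst)].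
  by rewrite sube_le0 -(condq _ GA); exact: q_le.
have Y_le0 A : G A -> (\int[P]_(x in A) (Y x)%:E <= 0)%E.
  move=> GA; have mA := Gm _ GA.
  rewrite (eq_integral ((EFin \o (fun x => (S' x - S x)%R)) \- (EFin \o m))%E)//.
  have iX : P.-integrable setT (EFin \o (fun x => S' x - S x)).
    exact: (integrableB measurableT iS' iS).
  rewrite integralB//; [|exact: (integrableS _ _ _ iX)|exact: (integrableS _ _ _ im)].
  by rewrite sube_le0 -(condm _ GA).
have iwY : P.-integrable setT (EFin \o (fun x => w1 x * Y x)).
  apply: (@integrableMr _ _ _ P setT measurableT w1 (EFin \o Y)) => //.
    exact: G_measurable_fun Gw1.
  exact: bounded_itv w1b.
have iwZ : P.-integrable setT (EFin \o (fun x => w2 x * Z x)).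
  apply: (@integrableMr _ _ _ P setT measurableT w2 (EFin \o Z)) => //.
    exact: G_measurable_fun Gw2.
  exact: bounded_itv w2b.
have ig0 : P.-integrable setT (EFin \o g0).
  apply: measurable_bounded_integrable => //.
  - exact: (le_lt_trans (probability_le1 P measurableT) (ltry _)).
  - exact: G_measurable_fun Gg0.
  - exact: bounded_itv g0b.
(* This is the square of the line plus [(k0 ^+ 2 - k ^+ 2) * v], a nonnegative surplus that makes
   the variance term use [k0]. *)
pose f2 x : R := g0 x + w1 x * Y x + w2 x * Z x.
have f2E x : f2 x = (b x + k x * Y x) ^+ 2 + (k0 x ^+ 2 - k x ^+ 2) * v.
  by rewrite /f2 /g0 /w1 /w2 /Z; ring.
have kk0sq x : 0 <= (k0 x ^+ 2 - k x ^+ 2) * v.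
  case/andP: (kk0 x) => h0 h1; rewrite mulr_ge0 ?(ltW v0)// subr_ge0.
  by rewrite ler_sqr ?nnegrE// (le_trans h0).
have if2 : P.-integrable setT (EFin \o f2).
  have -> : EFin \o f2 = (((EFin \o g0) \+ (EFin \o (fun x => w1 x * Y x)%R)) \+
      (EFin \o (fun x => w2 x * Z x)%R))%E by apply/funext => x.
  by apply: integrableD => //; apply: integrableD.
apply: (@le_trans _ _ (\int[P]_x (f2 x)%:E)%E).
  apply: ae_ge0_le_integral => //.
  - by move=> x _; rewrite lee_fin sqpos_ge0.
  - by apply: measurable_sqpos; apply/measurable_EFinP; exact: measurable_int iS'.
  - by move=> x _; rewrite lee_fin f2E addr_ge0 ?sqr_ge0.
  - exact: measurable_int if2.
  - apply: (filterS3 _ _ SB Xd m0) => x SxB Xxd mx0 _.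
    rewrite lee_fin f2E -[leLHS]addr0 lerD//.
    have mE : Num.min (m x) 0 = m x by apply/min_idPl.
    have -> : b x + k x * Y x = e x - k x * (d - (S' x - S x)).
      rewrite /b /k /z /Y mE; field; lra.
    rewrite (_ : S' x - t = (S' x - S x) - (t - S x)); last by ring.
    apply: sqpos_le_line => //.
      case/andP: (kk0 x) => h0 h1; case/andP: (k01 x) => h2 h3.
      by rewrite h0 (le_trans h1).
    rewrite /e (_ : Num.min _ _ = S x + d - t); last by apply/min_idPl; rewrite /C; lra.
    by rewrite le_max; apply/orP; right; lra.
have -> : (\int[P]_x (f2 x)%:E = \int[P]_x (g0 x)%:E +
   \int[P]_x (w1 x * Y x)%:E + \int[P]_x (w2 x * Z x)%:E)%E.
  rewrite (eq_integral (((EFin \o g0) \+ (EFin \o (fun x => w1 x * Y x)%R)) \+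
      (EFin \o (fun x => w2 x * Z x)%R))%E)//.
  by rewrite integralD//; [rewrite integralD|exact: integrableD].
apply: (@le_trans _ _ (\int[P]_x (g0 x)%:E)%E).
  rewrite -addeA; apply: geeDl; apply: adde_le0.
    apply: (integral_weight_le0 G Y w1 (2 * `|C|)) => //.
    by move=> a; exact: G_measurable_ge.
  apply: (integral_weight_le0 G Z w2 1) => //.
  by move=> a; exact: G_measurable_ge.
have mS' : measurable_fun setT S by exact: G_measurable_fun GS.
apply: ae_ge0_le_integral => //.
- by move=> x _; rewrite lee_fin; case/andP: (g0b x).
- exact: measurable_int ig0.
- move=> x _; rewrite lee_fin; apply: two_point_ge0 => [|?]; last exact: sqpos_ge0.
  by rewrite lerDl divr_ge0 ?sqr_ge0// ltW.
- rewrite /two_point; under eq_fun do rewrite EFinD !EFinM.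
  by apply: emeasurable_funD; apply: emeasurable_funM => //; exact: measurable_sqpos.
- apply: filterS SB => x SxB _; rewrite lee_fin /g0 /b /k0 slope_value// /two_point.
  have eE : e x = Num.max 0 (S x + d - t).
    by rewrite /e; congr (Num.max 0 _); apply/min_idPl; rewrite /C; lra.
  have -> : S x - (t - d + (1 + v / d ^+ 2) * d) =
     S x + d - t - (1 + v / d ^+ 2) * d by ring.
  have -> : S x - (t - d) = S x + d - t by ring.
  (* When [S x + d - t] is negative, [e x] is 0 and both sides vanish. *)
  rewrite eE; have [h|h] := leP 0 (S x + d - t); first by [].
  have ud : 0 <= (1 + v / d ^+ 2) * d.
    by rewrite mulr_ge0 ?addr_ge0 ?divr_ge0 ?sqr_ge0 ?ltW.
  by rewrite !sqpos_neg ?lexx//; lra.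
Qed.

End conditioning.

(** * Iteration along the supermartingale *)

Section supermartingale.
Context {R : realType} {dT : measure_display} {T : measurableType dT}.
Variable P : probability T R.

(** The integrands are signed, so the comparison goes through their difference, almost everywhere
    equal to its positive part. *)
Lemma ae_le_integral_fin (A : set T) (f g : T -> R) : measurable A ->
  P.-integrable setT (EFin \o f) -> P.-integrable setT (EFin \o g) ->
  {ae P, forall x, f x <= g x} ->
  (\int[P]_(x in A) (f x)%:E <= \int[P]_(x in A) (g x)%:E)%E.
Proof.
move=> mA intf intg fg.
have iAf : P.-integrable A (EFin \o f) by exact: (integrableS _ _ _ intf).
have iAg : P.-integrable A (EFin \o g) by exact: (integrableS _ _ _ intg).
rewrite -sube_ge0; last by rewrite (integrable_fin_num _ iAf).
rewrite -integralB//.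
have mB : measurable_fun A ((EFin \o g) \- (EFin \o f))%E.
  exact: measurable_int (integrableB mA iAg iAf).
rewrite (ae_eq_integral (fun x => maxe (((EFin \o g) \- (EFin \o f)) x) 0)%E)//.
- by apply: integral_ge0 => x _; rewrite le_max lexx orbT.
- exact: measurable_maxe.
- by apply: filterS fg => x fx _; rewrite max_l// lee_fin subr_ge0.
Qed.

Lemma markov_sqpos (S : T -> R) (y t : R) : measurable_fun setT S -> t < y ->
  (((y - t) ^+ 2)%:E * P [set x | (y <= S x)%R] <=
   \int[P]_x (sqpos (S x - t))%:E)%E.
Proof.
move=> mS ty; have yt : 0 < (y - t) ^+ 2 by rewrite exprn_gt0// subr_gt0.
have mf := measurable_sqpos S t mS.
have mA (a : R) (g : T -> R) : measurable_fun setT g -> measurable [set x | a <= g x].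
  move=> mg; apply: (@G_measurable_ge _ _ _ measurable) => B mB.
  by rewrite -[X in measurable X]setTI; exact: mg.
have := le_integral_abse P measurableT mf yt; rewrite setTI => H.
rewrite (eq_integral (fun x => `|(sqpos (S x - t))%:E|)%E); last first.
  by move=> x _; rewrite /= ger0_norm// sqpos_ge0.
apply: (le_trans _ H); apply: lee_pmul => //.
- by rewrite lee_fin ltW.
- apply: le_measure; rewrite ?inE; first exact: mA.
    rewrite (_ : [set x | _] = [set x | (y - t) ^+ 2 <= sqpos (S x - t)]); last first.
      by apply/seteqP; split=> x /=; rewrite lee_fin ger0_norm// sqpos_ge0.
    by apply: mA; exact/measurable_EFinP.
  move=> x /= yS; rewrite lee_fin ger0_norm ?sqpos_ge0// sqpos_pos; last lra.
  by rewrite ler_sqr ?nnegrE; lra.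
Qed.

(** The almost sure bound on [S n] is carried through the induction because [sqpos_step] needs it.
    The list is reversed so that the latest increment is the outermost operator. *)
Lemma supermartingale_sqpos (H : nat -> set (set T)) (S : nat -> T -> R)
  (d : R) (sigma : nat -> R) :
  (forall i, sigma_algebra setT (H i)) -> (forall i, H i `<=` measurable) ->
  (forall i, G_measurable (H i) (S i)) ->
  (forall i, P.-integrable setT (EFin \o S i)) ->
  (forall i, exists m, is_cond_exp P (H i) (S i.+1) m /\
                       {ae P, forall x, m x <= S i x}) ->
  {ae P, forall x, S 0%N x <= 0} -> 0 < d ->
  (forall i, (0 < i)%N -> 0 < sigma i) ->
  (forall i, {ae P, forall x, S i.+1 x - S i x <= d}) ->
  (forall i, exists m, is_cond_exp P (H i) (fun x => S i.+1 x - S i x) m /\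
     exists q, is_cond_exp_nneg P (H i)
                 (fun x => ((S i.+1 x - S i x - m x) ^+ 2)%:E) q /\
               {ae P, forall x, (q x <= (sigma i.+1 ^+ 2)%:E)%E}) ->
  forall n, {ae P, forall x, S n x <= n%:R * d} /\
    forall t, (\int[P]_x (sqpos (S n x - t))%:E <=
     (two_points d (rev [seq 1 + sigma i ^+ 2 / d ^+ 2 | i <- iota 1 n])
        (fun t => sqpos (- t)) t)%:E)%E.
Proof.
move=> sH Hm HS iS supS S0 d0 s0 Xd varX.
have mS i : measurable_fun setT (S i) by exact: G_measurable_fun (HS i).
have msq i t := measurable_sqpos (S i) t (mS i).
elim=> [|n [SB IH]].
  split; first by apply: filterS S0 => x; rewrite mul0r.
  move=> t /=; apply: (@le_trans _ _ (\int[P]_x (sqpos (- t))%:E)%E).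
    apply: ae_ge0_le_integral => //.
    - by move=> x _; rewrite lee_fin sqpos_ge0.
    - by move=> x _; rewrite lee_fin sqpos_ge0.
    - apply: filterS S0 => x Sx0 _; rewrite lee_fin sqpos_le//; lra.
  rewrite (@integral_cst _ _ _ P setT measurableT (sqpos (- t))%:E).
  rewrite -[leRHS]mule1; apply: lee_pmul => //; first by rewrite lee_fin sqpos_ge0.
  exact: probability_le1.
split.
  apply: filterS2 SB (Xd n) => x h1 h2; rewrite -natr1 mulrDl mul1r; lra.
move=> t; have [m [cm [q [cq qv]]]] := varX n.
have [m1 [[_ im1 cm1] m1S]] := supS n.
(* The increment has nonpositive integral over each set of [H n]: there [S n.+1] integrates like
   [m1], which is at most [S n]. *)
have m0 : {ae P, forall x, m x <= 0}.
  case: cm => Gmm im condm.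
  apply: (ae_le0_of_integral _ (H n)) => // A HA; have mA := Hm n _ HA.
  rewrite condm// (eq_integral ((EFin \o S n.+1) \- (EFin \o S n))%E)//.
  rewrite integralB//; [|exact: (integrableS _ _ _ (iS _))..].
  rewrite sube_le0 -cm1//; exact: ae_le_integral_fin.
have v0 : 0 < sigma n.+1 ^+ 2 by rewrite exprn_gt0// s0.
apply: (le_trans (sqpos_step _ _ _ _ _ _ _ _ _ t (sH n) (Hm n) (HS n) (iS n)
  (iS n.+1) SB (Xd n) cm m0 cq qv d0 v0)).
have -> : rev [seq 1 + sigma i ^+ 2 / d ^+ 2 | i <- iota 1 n.+1] =
    (1 + sigma n.+1 ^+ 2 / d ^+ 2) ::
    rev [seq 1 + sigma i ^+ 2 / d ^+ 2 | i <- iota 1 n].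
  rewrite (_ : iota 1 n.+1 = iota 1 n ++ [:: n.+1]) ?map_cat ?rev_cat//.
  by rewrite -(addn1 n) iotaD add1n addn1.
rewrite /=; move: (1 + _) (lerDl 1 (sigma n.+1 ^+ 2 / d ^+ 2)) => u.
rewrite divr_ge0 ?sqr_ge0// => u1.
have u0 : 0 <= u^-1 by rewrite invr_ge0 (le_trans ler01).
have u0' : 0 <= 1 - u^-1 by rewrite subr_ge0 invf_le1// (lt_le_trans ltr01).
(* The expectation passes inside the two-point average, whose weights are nonnegative, and the
   induction hypothesis applies at both shifted thresholds. *)
rewrite /two_point -/(two_points d _ _).
rewrite (eq_integral (fun x => (1 - u^-1)%:E * (sqpos (S n x - (t - d)))%:E +
  u^-1%:E * (sqpos (S n x - (t - d + u * d)))%:E)%E)//.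
rewrite ge0_integralD//; last 4 first.
- by move=> x _; rewrite -EFinM lee_fin mulr_ge0// sqpos_ge0.
- by apply: emeasurable_funM => //; exact: msq.
- by move=> x _; rewrite -EFinM lee_fin mulr_ge0// sqpos_ge0.
- by apply: emeasurable_funM => //; exact: msq.
have int0 r : (0 <= \int[P]_x (sqpos (S n x - r))%:E)%E.
  by apply: integral_ge0 => x _; rewrite lee_fin sqpos_ge0.
have intZ (c r : R) : 0 <= c -> (\int[P]_x (c%:E * (sqpos (S n x - r))%:E) =
    c%:E * \int[P]_x (sqpos (S n x - r))%:E)%E.
  move=> c0; rewrite ge0_integralZl_EFin//.
  by move=> x _; rewrite lee_fin sqpos_ge0.
rewrite !intZ//.
rewrite [leRHS]EFinD (EFinM (1 - u^-1)) (EFinM u^-1).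
by apply: leeD; apply: lee_pmul; rewrite ?lee_fin ?int0.
Qed.

End supermartingale.

(** * Smoothing by a uniform variable *)

Section smoothing.
Context {R : realType}.

Lemma nondecreasing_of_derive (f f' : R -> R) :
  (forall x : R, is_derive x 1 f (f' x)) -> (forall x, 0 <= f' x) ->
  {homo f : x y / x <= y}.
Proof.
move=> df f'0 x y xy.
have cf : {within `[x, y], continuous f}.
  apply: derivable_within_continuous => z _.
  by have [] := df z.
have [c _ E] := @MVT_segment R f f' x y xy (fun z _ => df z) cf.
by rewrite -subr_ge0 E mulr_ge0// subr_ge0.
Qed.

Lemma is_derive_max0X (k : nat) (x : R) :
  is_derive x 1 (fun y : R => Num.max y 0 ^+ k.+2)
    (k.+2%:R * Num.max x 0 ^+ k.+1).
Proof.
have [x0|x0|->] := ltgtP x 0.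
- rewrite expr0n /= mulr0.
  apply: (near_eq_is_derive _ (is_derive_cst (0 : R) x 1)).
  near=> y; have y0 : y <= 0 by apply: ltW; near: y; exact: lt_nbhsl.
  by rewrite /= (max_idPr y0) expr0n.
- have H := @is_deriveX R R id k.+2 x 1 1 (is_derive_id x 1).
  have E : (id : R -> R) ^+ k.+2 = (fun y : R => y ^+ k.+2).
    by apply/funext => y; rewrite fctE.
  rewrite E /GRing.scale /= mulr1 in H; apply: (near_eq_is_derive _ H).
  near=> y; have y0 : 0 <= y by apply: ltW; near: y; exact: lt_nbhsr.
  by rewrite (max_idPl y0).
(* At the kink the difference quotient is [Num.max z 0 ^+ k.+1], continuous with value 0. *)
- rewrite expr0n /= mulr0; apply/is_derive1_caratheodory.
  exists (fun z => Num.max z 0 ^+ k.+1); split.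
  + move=> z; rewrite maxxx expr0n /= !subr0.
    have [z0|z0] := leP z 0; first by rewrite !expr0n /= mul0r.
    by rewrite exprSr.
  + have cX : continuous (fun z : R => z ^+ k.+1) by move=> z; exact: exprn_continuous.
    apply: (@continuous_comp _ _ _ (fun z : R => Num.max z 0) (fun z => z ^+ k.+1)).
      by apply: continuous_max => //; first [exact: cvg_id|exact: cvg_cst].
    exact: cX.
  + by rewrite maxxx expr0n.
Unshelve. all: by end_near. Qed.


Lemma is_derive_fD (f g : R -> R) (x a b : R) : is_derive x 1 f a ->
  is_derive x 1 g b -> is_derive x 1 (fun t => f t + g t) (a + b).
Proof. exact: is_deriveD. Qed.

Lemma is_derive_fZ (f : R -> R) (k x a : R) : is_derive x 1 f a ->
  is_derive x 1 (fun t => k * f t) (k * a).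
Proof. exact: is_deriveZ. Qed.

Lemma is_derive_fsum (I : finType) (f : I -> R -> R) (x : R) (a : I -> R) :
  (forall i, is_derive x 1 (f i) (a i)) ->
  is_derive x 1 (fun t => \sum_i f i t) (\sum_i a i).
Proof.
move=> df; have -> : (fun t => \sum_i f i t) = \sum_i f i.
  by apply/funext => t; rewrite fct_sumE.
by elim/big_ind2 : _ => // [|] *; [exact: is_derive_cst|exact: is_deriveD].
Qed.

Lemma is_derive_max0X_rev (k : nat) (c x : R) :
  is_derive x 1 (fun t : R => Num.max (c - t) 0 ^+ k.+2)
    (- (k.+2%:R * Num.max (c - x) 0 ^+ k.+1)).
Proof.
have H : is_derive x 1 (fun t : R => c - t) (- 1).
  have := @is_deriveB _ _ _ (cst c) id x 1 0 1 (is_derive_cst c x 1) (is_derive_id x 1).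
  by rewrite sub0r.
have := @is_derive1_comp R (fun y => Num.max y 0 ^+ k.+2) (fun t => c - t) x _ _
  (is_derive_max0X k (c - x)) H.
by rewrite mulrN1.
Qed.

Lemma is_derive_expRM (l x : R) :
  is_derive x 1 (fun t : R => expR (- l * t)) (- l * expR (- l * x)).
Proof.
have H : is_derive x 1 (fun t : R => - l * t) (- l).
  by have := is_derive_fZ id (- l) x 1 (is_derive_id x 1); rewrite mulr1.
have := @is_derive1_comp R expR (fun t => - l * t) x _ _ (is_derive_expR _) H.
by rewrite mulrC.
Qed.

(* The right-hand side is E (s + U)_+^2 for U uniform on [-a, a], so this is
   Jensen's inequality. *)
Lemma sqpos_le_smooth (a s : R) : 0 < a ->
  sqpos s <= (Num.max (s + a) 0 ^+ 3 - Num.max (s - a) 0 ^+ 3) / (6 * a).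
Proof.
move=> a0; rewrite ler_pdivlMr ?mulr_gt0//.
have [s0|s0] := leP s 0.
  rewrite sqpos_neg// mul0r (@max_r _ _ (s - a)); last lra.
  by rewrite expr0n subr0 exprn_ge0// le_max lexx orbT.
rewrite (sqpos_pos (ltW s0)) (@max_l _ _ (s + a)); last lra.
have [sa|sa] := leP (s - a) 0; last first.
  have -> : (s + a) ^+ 3 - (s - a) ^+ 3 = s ^+ 2 * (6 * a) + a ^+ 3 *+ 2 by ring.
  by rewrite lerDl mulrn_wge0// exprn_ge0// ltW.
(* For [0 < s <= a] the second cube is cut off; [(a + s) ^+ 3 + (a - s) ^+ 3] equals
   [6 * a * s ^+ 2] plus twice [a ^+ 3]. *)
have -> : (s + a) ^+ 3 - 0 ^+ 3 =
    s ^+ 2 * (6 * a) + (a ^+ 3 *+ 2 - (a - s) ^+ 3) by rewrite !expr0n /=; ring.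
rewrite lerDl subr_ge0 (@le_trans _ _ (a ^+ 3))//.
  by apply: lerXn2r; rewrite ?nnegrE; lra.
by rewrite mulr2n lerDl exprn_ge0// ltW.
Qed.

(* Twice the hypothesis is the second derivative of E (s + U - t)_+^2 in t, so
   the difference of the two sides of the smoothed inequality is convex in t;
   it is nonincreasing and nonnegative for large t, hence everywhere. *)
Lemma weighted_sqpos_le (I : finType) (p s : I -> R) (a A l : R) : 0 < a ->
  0 < l -> (forall i, 0 <= p i) ->
  (forall x, \sum_i p i * (Num.max (s i + a - x) 0 - Num.max (s i - a - x) 0)
     / (2 * a) <= A * expR (- l * x)) ->
  forall t, \sum_i p i * sqpos (s i - t) <= 2 * A / l ^+ 2 * expR (- l * t).
Proof.
move=> a0 l0 p0 tail_le t.
have a_neq0 : a != 0 by rewrite gt_eqF.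
have l_neq0 : l != 0 by rewrite gt_eqF.
(* [D] is the right side minus the smoothed moment; [D1] and [D2] are its first two derivatives. *)
pose D (t : R) : R := 2 * A / l ^+ 2 * expR (- l * t) + \sum_i (- (p i / (6 * a))) *
  (Num.max (s i + a - t) 0 ^+ 3 + (- 1) * Num.max (s i - a - t) 0 ^+ 3).
pose D1 (t : R) : R := - (2 * A / l) * expR (- l * t) + \sum_i (p i / (2 * a)) *
  (Num.max (s i + a - t) 0 ^+ 2 + (- 1) * Num.max (s i - a - t) 0 ^+ 2).
pose D2 (t : R) : R := 2 * A * expR (- l * t) + \sum_i (- (p i / a)) *
  (Num.max (s i + a - t) 0 + (- 1) * Num.max (s i - a - t) 0).
have dD (x : R) : is_derive x 1 D (D1 x).
  have := is_derive_fD _ _ _ _ _ (is_derive_fZ _ (2 * A / l ^+ 2) _ _ (is_derive_expRM l x))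
    (is_derive_fsum _ _ _ _ (fun i => is_derive_fZ _ (- (p i / (6 * a))) _ _
      (is_derive_fD _ _ _ _ _ (is_derive_max0X_rev 1 (s i + a) x)
         (is_derive_fZ _ (- 1) _ _ (is_derive_max0X_rev 1 (s i - a) x))))).
  move=> H; apply: (is_derive_eq H); rewrite /D1; congr (_ + _); first by field.
  by apply: eq_bigr => i _; field.
have dD1 (x : R) : is_derive x 1 D1 (D2 x).
  have := is_derive_fD _ _ _ _ _ (is_derive_fZ _ (- (2 * A / l)) _ _ (is_derive_expRM l x))
    (is_derive_fsum _ _ _ _ (fun i => is_derive_fZ _ (p i / (2 * a)) _ _
      (is_derive_fD _ _ _ _ _ (is_derive_max0X_rev 0 (s i + a) x)
         (is_derive_fZ _ (- 1) _ _ (is_derive_max0X_rev 0 (s i - a) x))))).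
  move=> H; apply: (is_derive_eq H); rewrite /D2; congr (_ + _); first by field.
  by apply: eq_bigr => i _; rewrite !expr1; field.
have D2_ge0 x : 0 <= D2 x.
  have -> : D2 x = 2 * (A * expR (- l * x) - \sum_i p i *
      (Num.max (s i + a - x) 0 - Num.max (s i - a - x) 0) / (2 * a)).
    rewrite mulrBr mulrA big_distrr /= /D2 -sumrN; congr (_ + _).
    by apply: eq_bigr => i _; field.
  by rewrite mulr_ge0// subr_ge0.
have D1_ndecr := nondecreasing_of_derive _ _ dD1 D2_ge0.
(* A point to the right of [t] and of all the kinks, so that only the exponential terms remain from
   there on. *)
pose M := \sum_i `|s i| + a + `|t|.
have large x i : M <= x -> (s i + a - x <= 0) /\ (s i - a - x <= 0).
  move=> Mx; have : s i <= \sum_i `|s i|.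
    apply: (le_trans (ler_norm _)); rewrite (bigD1 i)//= lerDl.
    by apply: sumr_ge0 => j _; exact: normr_ge0.
  by have := normr_ge0 t; rewrite /M in Mx; split; lra.
have A0 : 0 <= A.
  have := tail_le 0; rewrite mulr0 expR0 mulr1; apply: le_trans.
  apply: sumr_ge0 => i _; rewrite divr_ge0 ?mulr_ge0 ?(ltW a0)//.
  by rewrite subr_ge0 le_max2// lerD2r lerD2l; lra.
(* [D1] is nondecreasing, and beyond [M] it is a nonpositive multiple of an exponential. *)
have D1_le0 x : D1 x <= 0.
  apply: (@le_trans _ _ (D1 (Num.max x M))).
    by apply: D1_ndecr; rewrite le_max lexx.
  rewrite /D1 big1 ?addr0; last first.
    move=> i _; have [|h1 h2] := large (Num.max x M) i; first by rewrite le_max lexx orbT.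
    by rewrite (max_idPr h1) (max_idPr h2) !expr0n /= mulr0 addr0 mulr0.
  by rewrite mulNr oppr_le0 mulr_ge0 ?expR_ge0// divr_ge0 ?mulr_ge0// ltW.
have ND_ndecr := nondecreasing_of_derive (fun x => (- 1) * D x)
  (fun x => (- 1) * D1 x) (fun x => is_derive_fZ _ (- 1) _ _ (dD x)).
have : D M <= D t.
  have := ND_ndecr _ t M; rewrite !mulN1r lerN2; apply.
    by move=> x; rewrite mulN1r oppr_ge0.
  rewrite /M; have := ler_norm t; have : 0 <= \sum_i `|s i|.
    by apply: sumr_ge0 => j _; exact: normr_ge0.
  by lra.
have DM : 0 <= D M.
  rewrite /D big1 ?addr0; last first.
    move=> i _; have [|h1 h2] := large M i; first exact: lexx.
    by rewrite (max_idPr h1) (max_idPr h2) !expr0n /= mulr0 addr0 mulr0.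
  by rewrite mulr_ge0 ?expR_ge0// divr_ge0 ?sqr_ge0 ?mulr_ge0.
move=> /(le_trans DM); rewrite /D.
have -> : \sum_i (- (p i / (6 * a))) * (Num.max (s i + a - t) 0 ^+ 3 +
    (- 1) * Num.max (s i - a - t) 0 ^+ 3) =
  - \sum_i p i * ((Num.max (s i + a - t) 0 ^+ 3 - Num.max (s i - a - t) 0 ^+ 3)
    / (6 * a)).
  by rewrite -sumrN; apply: eq_bigr => i _; field.
rewrite subr_ge0; apply: le_trans; apply: ler_sum => i _.
apply: ler_wpM2l => //.
have -> : s i + a - t = s i - t + a by ring.
have -> : s i - a - t = s i - t - a by ring.
exact: sqpos_le_smooth.
Qed.

End smoothing.

(** * The majorant and the binomial tail *)

Section log_concavity.
Context {R : realType}.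
Implicit Types (g : R -> R) (x y z : R).

Lemma log_concave_fin g x y z t : log_concave g -> 0 <= t <= 1 ->
  z = t * x + (1 - t) * y -> 0 < g x -> 0 < g y -> 0 < g z ->
  t * ln (g x) + (1 - t) * ln (g y) <= ln (g z).
Proof.
move=> [_ H] t01 -> gx gy gz; have := H x y t t01.
by rewrite /lnE !gt_eqF// -!EFinM -EFinD lee_fin.
Qed.

Lemma log_concave_slopes g x y z : log_concave g -> x < y -> y < z ->
  0 < g x -> 0 < g y -> 0 < g z ->
  (ln (g z) - ln (g y)) / (z - y) <= (ln (g y) - ln (g x)) / (y - x).
Proof.
move=> lc xy yz gx gy gz.
have zx : 0 < z - x by lra.
have t01 : 0 <= (z - y) / (z - x) <= 1.
  by rewrite divr_ge0 ?ler_pdivrMr//=; lra.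
rewrite ler_pdivrMr ?subr_gt0// [leRHS]mulrAC ler_pdivlMr ?subr_gt0//.
have : (z - y) / (z - x) * ln (g x) + (1 - (z - y) / (z - x)) * ln (g z) <= ln (g y).
  by apply: log_concave_fin => //; field; lra.
rewrite -(ler_pM2r zx).
have -> : ((z - y) / (z - x) * ln (g x) + (1 - (z - y) / (z - x)) * ln (g z)) *
  (z - x) = (z - y) * ln (g x) + (y - x) * ln (g z) by field; lra.
lra.
Qed.

(** The rate is minus the supremum of the chord slopes of [ln g] to the right of [y]; by concavity
    every slope to the left bounds these from above. *)
Lemma log_concave_support g (y b : R) : log_concave g -> y < b ->
  (forall x, x < b -> 0 < g x) ->
  exists l, forall x, x < b -> g x <= g y * expR (- l * (x - y)).
Proof.
move=> lc yb g0.
pose E := [set (ln (g z) - ln (g y)) / (z - y) | z in [set z | y < z < b]].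
have ubE x : x < y -> ubound E ((ln (g y) - ln (g x)) / (y - x)).
  move=> xy _ [z /= /andP[yz zb] <-].
  by apply: log_concave_slopes => //; apply: g0 => //; lra.
have supE : has_sup E.
  split; last by exists ((ln (g y) - ln (g (y - 1))) / (y - (y - 1))); apply: ubE; lra.
  by exists ((ln (g ((y + b) / 2)) - ln (g y)) / ((y + b) / 2 - y)), ((y + b) / 2) => //=; lra.
exists (- sup E) => x xb; rewrite opprK.
have -> : g y = expR (ln (g y)) by rewrite lnK// posrE g0.
rewrite -expRD -[leLHS]lnK ?posrE ?g0// ler_expR.
have [xy|yx|->] := ltgtP x y; last by rewrite subrr mulr0 addr0.
- have := ge_sup supE.1 (ubE x xy); rewrite ler_pdivlMr ?subr_gt0//; lra.
- have : (ln (g x) - ln (g y)) / (x - y) <= sup E.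
    by apply: (ub_le_sup supE.2); exists x => //=; rewrite yx xb.
  by rewrite ler_pdivrMr ?subr_gt0//; lra.
Qed.

(** The constant 1 dominates the interpolated tail, so the infimum that defines the majorant is over
    a nonempty set. *)
Lemma log_concave_cst1 : log_concave (fun _ : R => 1).
Proof.
split=> [x|x y t _]; first exact: ler01.
by rewrite /lnE oner_eq0 ln1 !mule0 adde0.
Qed.

End log_concavity.

(** * The sum of two-point variables and its interpolated tail *)

Section binomial_tail.
Context {R : realType}.
Implicit Types (d v : R) (n : nat).

Definition Tprob {n} d v (z : {ffun 'I_n -> bool}) := \prod_(i < n) Zprob d v (z i).
Definition Tval {n} d v (z : {ffun 'I_n -> bool}) := \sum_(i < n) Zval d v (z i).

Lemma Tprob_gt0 n d v (z : {ffun 'I_n -> bool}) : 0 < d -> 0 < v ->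
  0 < Tprob d v z.
Proof.
move=> d0 v0; have D0 : 0 < d ^+ 2 + v by rewrite addr_gt0// exprn_gt0.
apply: prodr_gt0 => i _; rewrite /Zprob; case: (z i); rewrite divr_gt0//.
exact: exprn_gt0.
Qed.

Lemma Tprob_sum n d v : 0 < d -> 0 < v ->
  \sum_(z : {ffun 'I_n -> bool}) Tprob d v z = 1.
Proof.
move=> d0 v0; have D0 : 0 < d ^+ 2 + v by rewrite addr_gt0// exprn_gt0.
rewrite -(bigA_distr_bigA (fun _ b => Zprob d v b)) /= big1// => i _.
by rewrite big_bool /= -mulrDl addrC divff// gt_eqF.
Qed.

Lemma Tval_lattice n d v (z : {ffun 'I_n -> bool}) : d != 0 ->
  Tval d v z = n%:R * d - (\sum_(i < n) ~~ z i)%N%:R * (d + v / d).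
Proof.
move=> d0; rewrite natr_sum mulr_suml -[n in n%:R]card_ord -sum1_card natr_sum.
rewrite mulr_suml -sumrB; apply: eq_bigr => i _.
by rewrite /Zval; case: (z i) => /=; rewrite ?mul0r ?mul1r ?subr0//; ring.
Qed.

Definition ffun_cons {n} b (f : {ffun 'I_n -> bool}) : {ffun 'I_n.+1 -> bool} :=
  [ffun i => if unlift ord0 i is Some j then f j else b].

Lemma sum_ffun_cons n (F : {ffun 'I_n.+1 -> bool} -> R) :
  \sum_z F z = \sum_b \sum_f F (ffun_cons b f).
Proof.
rewrite pair_big /= (reindex (fun q : bool * {ffun 'I_n -> bool} => ffun_cons q.1 q.2)) //.
exists (fun z : {ffun 'I_n.+1 -> bool} => (z ord0, [ffun j : 'I_n => z (lift ord0 j)])).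
  move=> [b f] _ /=; congr (_, _); first by rewrite ffunE unlift_none.
  by apply/ffunP => j; rewrite !ffunE liftK.
move=> z _; apply/ffunP => i; rewrite ffunE /=.
by case: unliftP => [j|] ->; rewrite ?ffunE.
Qed.

(** With [u = 1 + v / d ^+ 2] the operator averages over the law of one [Z_i]. For
    [V t = sqpos (- t)] the result is [E (T_n - t)_+^2]. *)
Lemma two_points_Tsum n d v V t : 0 < d -> 0 < v ->
  two_points d (nseq n (1 + v / d ^+ 2)) V t =
  \sum_(z : {ffun 'I_n -> bool}) Tprob d v z * V (t - Tval d v z).
Proof.
move=> d0 v0; have dn0 : d != 0 by rewrite gt_eqF.
have D0 : d ^+ 2 + v != 0 by rewrite gt_eqF// addr_gt0// exprn_gt0.
elim: n t => [|n IH] t.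
  rewrite /= (bigD1 [ffun=> true])//= big1 ?addr0; last first.
    by move=> z /eqP []; apply/ffunP => -[].
  by rewrite /Tprob /Tval !big_ord0 mul1r subr0.
rewrite sum_ffun_cons big_bool /= /two_point !IH.
have Einv := invr_1Dratio d v dn0.
have consE b (f : {ffun 'I_n -> bool}) : Tprob d v (ffun_cons b f) =
    Zprob d v b * Tprob d v f /\ Tval d v (ffun_cons b f) = Zval d v b + Tval d v f.
  split; rewrite /Tprob /Tval big_ord_recl ffunE unlift_none;
    by congr (_ _ _); apply: eq_bigr => i _; rewrite ffunE liftK.
rewrite !mulr_sumr; congr (_ + _); apply: eq_bigr => f _;
  rewrite (consE _ _).1 (consE _ _).2 mulrA /Zprob /Zval /=; congr (_ * _ * V _).
- by rewrite Einv; field.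
- by ring.
- by rewrite Einv.
- by field.
Qed.

(** The probability that [r + U >= 0] for [U] uniform on [0, 1]. As a difference of positive parts
    it fits the hypothesis of [weighted_sqpos_le]. *)
Definition ramp (r : R) := Num.max (r + 1) 0 - Num.max r 0.

Lemma ramp_ge0 r : 0 <= ramp r.
Proof. by rewrite subr_ge0 le_max2// lerDl. Qed.

Lemma ramp_gt0 r : -1 < r -> 0 < ramp r.
Proof.
move=> r1; rewrite /ramp; have [] := leP r 0; have [] := leP (r + 1) 0; lra.
Qed.

Lemma ramp1 r : 0 <= r -> ramp r = 1.
Proof. by move=> r0; rewrite /ramp !max_l//; lra. Qed.

Lemma ramp0 r : r <= -1 -> ramp r = 0.
Proof. by move=> r0; rewrite /ramp !max_r ?subrr//; lra. Qed.

Lemma ramp_le1 r : ramp r <= 1.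
Proof. by rewrite /ramp; have [] := leP r 0; have [] := leP (r + 1) 0; lra. Qed.

(** The interpolation is linear in the tail, so it acts on each outcome separately, and the
    interpolated indicator of a lattice half-line is a ramp of width one lattice step. *)
Lemma TtailLin_ramp n d v x : 0 < d -> 0 < v ->
  TtailLin n d v (d + v / d) x =
  \sum_(z : {ffun 'I_n -> bool}) Tprob d v z * ramp ((Tval d v z - x) / (d + v / d)).
Proof.
move=> d0 v0; have h0 : 0 < d + v / d by rewrite addr_gt0// divr_gt0.
rewrite /TtailLin /Ttail; set h := d + v / d in h0 *.
set k := Num.floor _; set gam := (_ / h).
rewrite 2!(big_mkcond (fun z : {ffun 'I_n -> bool} => _ <= _)) !mulr_sumr -big_split /=.
apply: eq_bigr => z _; rewrite -/(Tval d v z) -/(Tprob d v z).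
rewrite Tval_lattice ?gt_eqF//; set c := (\sum_(i < n) ~~ z i)%N; rewrite -/h.
have hn0 : h != 0 by rewrite gt_eqF.
have gamE : (x - n%:R * d) / h = k%:~R + gam by rewrite /gam; field.
have [g0 g1] : 0 <= gam /\ gam < 1.
  have := floor_le ((x - n%:R * d) / h); have := floorD1_gt ((x - n%:R * d) / h).
  by rewrite -/k gamE intrD; lra.
have -> : (n%:R * d - c%:R * h - x) / h = - (c%:R + k%:~R) - gam.
  have -> : x = n%:R * d + (k%:~R + gam) * h by rewrite -gamE; field.
  by field.
have cmp (m : int) : (n%:R * d + m%:~R * h <= n%:R * d - c%:R * h) = (m + c%:Z <= 0).
  rewrite lerD2l -mulNr ler_pM2r// -lerBrDr sub0r -(ler_int R).
  by rewrite mulrNz.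
rewrite !cmp; set j := (k + c%:Z).
have -> : c%:R + k%:~R = j%:~R :> R by rewrite /j intrD addrC.
have -> : (k + 1 + c%:Z) = j + 1 by rewrite /j addrAC.
(* The outcome lies above both interpolation nodes if [j < 0], above neither if [j > 0], and exactly
   on the lower one if [j = 0], where it contributes [1 - gam]. *)
have [j0|j0|j0] := ltgtP j 0.
- rewrite (_ : j + 1 <= 0); last by rewrite lezD1.
  rewrite ramp1; first by ring.
  have : (j + 1)%:~R <= 0 :> R by rewrite lerz0 lezD1.
  by rewrite intrD; lra.
- rewrite (_ : (j + 1 <= 0) = false); last by apply/negbTE; rewrite -ltNge ltzD1 ltW.
  rewrite ramp0; first by ring.
  have : 1 <= j%:~R :> R by rewrite ler1z -gtz0_ge1.
  by lra.
- rewrite j0 /= /ramp oppr0 sub0r max_l; last lra.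
  by rewrite max_r; [ring|lra].
Qed.

End binomial_tail.

(** * From moments to tails *)

Section tail_comparison.
Context {R : realType}.
Implicit Types (d v : R) (n : nat).

Lemma TtailLin_le1 n d v x : 0 < d -> 0 < v -> TtailLin n d v (d + v / d) x <= 1.
Proof.
move=> d0 v0; rewrite TtailLin_ramp// -(Tprob_sum n d v d0 v0).
by apply: ler_sum => z _; rewrite ler_piMr ?ramp_le1// ltW// Tprob_gt0.
Qed.

Lemma TtailLin_low n d v x : 0 < d -> 0 < v ->
  x <= n%:R * d - n%:R * (d + v / d) -> TtailLin n d v (d + v / d) x = 1.
Proof.
move=> d0 v0 xn; have h0 : 0 < d + v / d by rewrite addr_gt0// divr_gt0.
rewrite TtailLin_ramp// -(Tprob_sum n d v d0 v0).
apply: eq_bigr => z _; rewrite ramp1 ?mulr1//.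
rewrite divr_ge0 ?(ltW h0)// subr_ge0 (le_trans xn)// Tval_lattice ?gt_eqF//.
rewrite lerD2l lerN2 ler_wpM2r ?(ltW h0)// ler_nat.
rewrite -[leqRHS]card_ord -sum1_card; apply: leq_sum => i _; exact: leq_b1.
Qed.

(** The interpolation reaches 0 only one lattice step beyond the largest value [n%:R * d]; the
    outcome attaining that value gives a positive term. *)
Lemma TtailLin_gt0 n d v x : 0 < d -> 0 < v ->
  x < n%:R * d + (d + v / d) -> 0 < TtailLin n d v (d + v / d) x.
Proof.
move=> d0 v0 xn; have h0 : 0 < d + v / d by rewrite addr_gt0// divr_gt0.
rewrite TtailLin_ramp// (bigD1 [ffun=> true])//= ltr_wpDr//.
  by apply: sumr_ge0 => z _; rewrite mulr_ge0 ?ramp_ge0// ltW// Tprob_gt0.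
rewrite mulr_gt0 ?Tprob_gt0//; apply: ramp_gt0.
rewrite Tval_lattice ?gt_eqF// big1; last by move=> i _; rewrite ffunE.
by rewrite mul0r subr0 ltr_pdivlMr// mulN1r; lra.
Qed.

Lemma TtailLin_high n d v x : 0 < d -> 0 < v ->
  n%:R * d + (d + v / d) <= x -> TtailLin n d v (d + v / d) x = 0.
Proof.
move=> d0 v0 xn; have h0 : 0 < d + v / d by rewrite addr_gt0// divr_gt0.
rewrite TtailLin_ramp// big1// => z _; rewrite ramp0 ?mulr0//.
rewrite ler_pdivrMr// mulN1r Tval_lattice ?gt_eqF//.
have : 0 <= (\sum_(i < n) ~~ z i)%N%:R * (d + v / d) by rewrite mulr_ge0 ?(ltW h0).
lra.
Qed.

(** The condition [y <= n%:R * d] puts [y + h / 2] in the region where the interpolated tail is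
    positive, so [g] has a supporting exponential there. *)
Lemma tail_le_log_concave n d v (g : R -> R) (y pr : R) : 0 < d -> 0 < v ->
  log_concave g -> (forall x, TtailLin n d v (d + v / d) x <= g x) ->
  y <= n%:R * d -> pr <= 1 ->
  (forall t, t < y -> (y - t) ^+ 2 * pr <=
    two_points d (nseq n (1 + v / d ^+ 2)) (fun t => sqpos (- t)) t) ->
  pr <= expR 2 / 2 * g (y + (d + v / d) / 2).
Proof.
move=> d0 v0 lc Lg yn pr1 Hpr.
have h0 : 0 < d + v / d by rewrite addr_gt0// divr_gt0.
have dn0 : d != 0 by rewrite gt_eqF.
set h := d + v / d in h0 Lg *; set y0 := y + h / 2.
have g_gt0 x : x < n%:R * d + h -> 0 < g x.
  by move=> xb; apply: lt_le_trans (Lg x); exact: TtailLin_gt0.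
have y0b : y0 < n%:R * d + h by rewrite /y0; lra.
have [l Hl] := log_concave_support g y0 _ lc y0b g_gt0.
(* The support bound holds only left of [n%:R * d + h], but from there on the interpolated tail is
   0. *)
have Lin_le x : TtailLin n d v h x <= g y0 * expR (- l * (x - y0)).
  have [xb|xb] := leP (n%:R * d + h) x; last exact: le_trans (Lg x) (Hl x xb).
  by rewrite TtailLin_high// mulr_ge0 ?expR_ge0// ltW// g_gt0.
(* If [l <= 0], the exponential is at most 1 to the left of [y0], while the interpolated tail equals
   1 far to the left; so [g y0 >= 1]. *)
have [l0|l0] := leP l 0.
  have g1 : 1 <= g y0.
    pose x := Num.min (n%:R * d - n%:R * h) y0.
    have := Lin_le x; rewrite TtailLin_low//; last by rewrite ge_min lexx.
    move=> /le_trans; apply; rewrite ler_piMr ?(ltW (g_gt0 _ _))//.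
    rewrite -expR0 ler_expR; apply: mulr_ge0_le0; first by rewrite oppr_ge0.
    by rewrite subr_le0 ge_min lexx orbT.
  have e2 : 2 <= expR 2 :> R by have := expR_ge1Dx (2 : R); lra.
  apply: (le_trans pr1); rewrite -[1]mulr1; apply: ler_pM => //.
  by rewrite ler_pdivlMr ?mul1r.
pose A := g y0 * expR (l * y).
have tail_le x : \sum_(z : {ffun 'I_n -> bool}) Tprob d v z *
    (Num.max (Tval d v z + h / 2 - x) 0 - Num.max (Tval d v z - h / 2 - x) 0)
    / (2 * (h / 2)) <= A * expR (- l * x).
  have := Lin_le (x + h / 2); rewrite TtailLin_ramp// -/h.
  have -> : g y0 * expR (- l * (x + h / 2 - y0)) = A * expR (- l * x).
    by rewrite /A -mulrA -expRD; congr (_ * expR _); rewrite /y0; ring.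
  apply: le_trans; apply: ler_sum => z _; rewrite -mulrA ler_wpM2l//.
    by rewrite ltW// Tprob_gt0.
  have hn0 : h != 0 by rewrite gt_eqF.
  rewrite (_ : 2 * (h / 2) = h); last by field.
  rewrite mulrBl /ramp !maxr_pMl ?invr_ge0 ?(ltW h0)// !mul0r.
  have -> : (Tval d v z - (x + h / 2)) / h + 1 = (Tval d v z + h / 2 - x) / h by field.
  have -> : Tval d v z - (x + h / 2) = Tval d v z - h / 2 - x by ring.
  exact: lexx.
have h2 : 0 < h / 2 by lra.
have l_neq0 : l != 0 by rewrite gt_eqF.
(* This choice minimises [expR (l * (y - t)) / (y - t) ^+ 2] over [t < y]. *)
pose t := y - 2 / l.
have ty : t < y by rewrite /t ltrBlDr ltrDl divr_gt0.
have := Hpr t ty; rewrite two_points_Tsum//.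
have := weighted_sqpos_le _ _ _ _ _ _ h2 l0 (fun z => ltW (Tprob_gt0 n d v z d0 v0)) tail_le t.
have E : 2 * A / l ^+ 2 * expR (- l * t) = 4 / l ^+ 2 * (expR 2 / 2 * g y0).
  have -> : expR 2 = expR (l * y) * expR (- l * t) :> R.
    by rewrite -expRD /t; congr expR; field.
  by rewrite /A; field.
rewrite E => H1 H2; have l2 : 0 < 4 / l ^+ 2 by rewrite divr_gt0// exprn_gt0.
rewrite -(ler_pM2l l2); apply: le_trans H1.
have -> : 4 / l ^+ 2 * pr = (y - t) ^+ 2 * pr by rewrite /t; field.
apply: (le_trans H2); apply: ler_sum => z _.
by rewrite opprB.
Qed.

End tail_comparison.

Theorem theorem2p3 (R : realType) (dT : measure_display) (T : measurableType dT)
  (P : probability T R) (H : nat -> set (set T)) (S : nat -> T -> R)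
  (d : R) (sigma : nat -> R) (n : nat) :
  (* filtration of sub-sigma-algebras *)
  (forall i, sigma_algebra setT (H i)) ->
  (forall i, H i `<=` measurable) ->
  (forall i, H i `<=` H i.+1) ->
  (* (S_i) is an integrable adapted supermartingale *)
  (forall i, G_measurable (H i) (S i)) ->
  (forall i, P.-integrable setT (EFin \o S i)) ->
  (forall i, exists m, is_cond_exp P (H i) (S i.+1) m /\
                       {ae P, forall x, m x <= S i x}) ->
  {ae P, forall x, S 0%N x <= 0} ->
  0 < d ->
  (forall i, (0 < i)%N -> 0 < sigma i) ->
  (* X_{i+1} := S_{i+1} - S_i <= d a.s. *)
  (forall i, {ae P, forall x, S i.+1 x - S i x <= d}) ->
  (* Var(X_{i+1} | H_i) <= sigma_{i+1}^2 a.s. *)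
  (forall i, exists m, is_cond_exp P (H i) (fun x => S i.+1 x - S i x) m /\
     exists q, is_cond_exp_nneg P (H i)
                 (fun x => ((S i.+1 x - S i x - m x) ^+ 2)%:E) q /\
               {ae P, forall x, (q x <= (sigma i.+1 ^+ 2)%:E)%E}) ->
  (1 <= n)%N ->
  let s2 := (\sum_(1 <= i < n.+1) sigma i ^+ 2) / n%:R in
  let h := d + s2 / d in
  forall y : R,
    (P [set x | (y <= S n x)%R] <=
       ((expR 2 / 2) * TtailLinLC n d s2 h (y + h / 2))%:E)%E.
Proof.
move=> sH Hm _ HS iS supS S0 d0 s0 Xd varX n1 s2 h y.
have n0 : 0 < n%:R :> R by rewrite ltr0n.
have s20 : 0 < s2.
  rewrite divr_gt0// big_nat_recl//= ltr_wpDr ?exprn_gt0 ?s0//.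
  by apply: sumr_ge0 => i _; exact: sqr_ge0.
have h0 : 0 < h by rewrite addr_gt0// divr_gt0.
have mS : measurable_fun setT (S n) by exact: G_measurable_fun (Hm n) (HS n).
have mA : measurable [set x | y <= S n x] by apply: Hm; exact: G_measurable_ge (HS n).
have [Sn_le moment] := supermartingale_sqpos P H S d sigma sH Hm HS iS supS S0 d0 s0 Xd varX n.
pose pr := fine (P [set x | y <= S n x]).
have prE : P [set x | y <= S n x] = pr%:E by rewrite fineK// fin_num_measure.
have pr1 : pr <= 1 by rewrite -lee_fin -prE; exact: probability_le1.
have prt t : t < y -> (y - t) ^+ 2 * pr <=
    two_points d (nseq n (1 + s2 / d ^+ 2)) (fun t => sqpos (- t)) t.
  move=> ty; rewrite -lee_fin EFinM -prE.
  apply: (le_trans (markov_sqpos P (S n) y t mS ty)); apply: (le_trans (moment t)).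
  set us := rev _; have szu : size us = n by rewrite size_rev size_map size_iota.
  rewrite lee_fin -[in nseq n _]szu; apply: two_points_mean => //.
    rewrite all_rev all_map; apply/allP => i _ /=.
    by rewrite lerDl divr_ge0// sqr_ge0.
  (* The entries have mean [1 + s2 / d ^+ 2]. *)
  rewrite szu (perm_big _ (permEl (perm_rev _))) big_map big_split /= -mulr_suml.
  rewrite mulrDr mulr1 big_const_seq count_predT size_iota iter_addr_0; congr (_ + _).
  rewrite /s2 /index_iota subSS subn0; field.
  by rewrite !gt_eqF.
rewrite prE lee_fin; set c2 := expR 2 / 2.
have c20 : 0 < c2 by rewrite divr_gt0// expR_gt0.
(* It suffices to bound [pr / c2] by each log-concave majorant at the point. *)
rewrite mulrC -ler_pdivrMr//; apply: lb_le_inf.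
  exists 1; exists (fun=> 1) => //; split; first exact: log_concave_cst1.
  by move=> x; exact: TtailLin_le1.
move=> _ [g [lc Lg] <-]; rewrite ler_pdivrMr// mulrC.
(* Beyond [n%:R * d] the majorant may vanish, but so does the probability, as [S n <= n%:R * d]
   almost surely. *)
have [yn|yn] := leP y (n%:R * d); first exact: (tail_le_log_concave n d s2).
suff -> : pr = 0 by rewrite mulr_ge0 ?(ltW c20)//; case: lc.
suff PA : P [set x | y <= S n x] = 0%E by rewrite /pr PA.
apply: measure_negligible => //; apply: negligibleS Sn_le => x /= yS; apply/negP.
by rewrite -ltNge (lt_le_trans yn).
Qed.
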